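(* Fix $\omega>0$. Assume that $f:\mathbb{R}_+\times\mathbb{L}^2(\mathbb{P},\mathbb{H})\to\mathbb{L}^2(\mathbb{P},\mathbb{H})$ is a square mean $\omega$-periodic limit process in $t\in\mathbb{R}_+$ uniformly for $Y$ in bounded sets of $\mathbb{L}^2(\mathbb{P},\mathbb{H})$ and satisfies the Lipschitz condition, that is, there exists a constant $L>0$ such that $$\mathbb{E}\|f(t,Y)-f(t,Z)\|^2\le L\,\mathbb{E}\|Y-Z\|^2\quad\forall t\ge0,\ \forall Y,Z\in\mathbb{L}^2(\mathbb{P},\mathbb{H}).$$ Let $X:\mathbb{R}_+\to\mathbb{L}^2(\mathbb{P},\mathbb{H})$ be a square mean $\omega$-periodic limit process. Then the process $F=(F(t))_{t\ge0}$, $F(t)=f(t,X(t))$, is a square mean $\omega$-periodic limit process.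
   Context: $(\mathbb{H},\|\cdot\|)$ is a real separable Hilbert space, $(\Omega,\mathcal{F},\mathbb{P})$ a probability space, and $\mathbb{L}^2(\mathbb{P},\mathbb{H})$ is the Hilbert space of strongly measurable $\mathbb{H}$-valued random variables $X$ with $\mathbb{E}\|X\|^2<\infty$, with norm $\|X\|_2=(\mathbb{E}\|X\|^2)^{1/2}$. A process $X:\mathbb{R}_+\to\mathbb{L}^2(\mathbb{P},\mathbb{H})$ is continuous if $\lim_{t\to s}\mathbb{E}\|X(t)-X(s)\|^2=0$ for every $s$, and bounded if there is $K>0$ with $\mathbb{E}\|X(t)\|^2\le K$ for all $t\ge 0$. A continuous and bounded process $X$ is square mean $\omega$-periodic limit if there is a process $\tilde X:\mathbb{R}_+\to\mathbb{L}^2(\mathbb{P},\mathbb{H})$ (not necessarily continuous) with $\lim_{n\to+\infty}\mathbb{E}\|X(t+n\omega)-\tilde X(t)\|^2=0$ ($n\in\mathbb{N}$) for each $t\ge0$. A continuous bounded process $f:\mathbb{R}_+\times\mathbb{L}^2(\mathbb{P},\mathbb{H})\to\mathbb{L}^2(\mathbb{P},\mathbb{H})$ is square mean $\omega$-periodic limit in $t\in\mathbb{R}_+$ uniformly for $X$ in bounded sets of $\mathbb{L}^2(\mathbb{P},\mathbb{H})$ if for every bounded subset $K$ of $\mathbb{L}^2(\mathbb{P},\mathbb{H})$ the set $\{f(t,X):t\in\mathbb{R}_+,X\in K\}$ is bounded and there is a process $\tilde f:\mathbb{R}_+\times\mathbb{L}^2(\mathbb{P},\mathbb{H})\to\mathbb{L}^2(\mathbb{P},\mathbb{H})$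 with $\lim_{n\to+\infty}\mathbb{E}\|f(t+n\omega,X)-\tilde f(t,X)\|^2=0$ ($n\in\mathbb{N}$) for each $t\ge 0$ and each $X\in K$. *)

(* Defs.v *)
From HB Require Import structures.
From mathcomp Require Import all_boot all_order all_algebra.
From mathcomp Require Import all_classical all_reals all_analysis.
From mathcomp Require Import measurable_realfun.

Set Implicit Arguments.
Unset Strict Implicit.
Unset Printing Implicit Defensive.

Import Order.TTheory GRing.Theory Num.Theory.
Import numFieldNormedType.Exports.

Local Open Scope classical_set_scope.
Local Open Scope ring_scope.

(* Completeness comes from the [completeNormedModType] structure. *)
Definition hilbert_norm (R : realType) (H : completeNormedModType R) : Prop :=
  exists dot : {dot H for @idfun R}, forall x : H, `|x| ^+ 2 = dot x x.

Definition separable_space (H : topologicalType) : Prop :=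
  exists2 D : set H, countable D & dense D.

Section L2.
Context (d : measure_display) (T : measurableType d) (R : realType).
Context (P : probability T R) (H : completeNormedModType R).

(* The library's [{sfun T >-> R}] only covers real-valued functions. *)
Definition simple_function (s : T -> H) : Prop :=
  finite_set (range s) /\ forall y : H, measurable (s @^-1` [set y]).

Definition strongly_measurable (X : T -> H) : Prop :=
  exists2 s : nat -> T -> H, (forall n, simple_function (s n)) &
    forall w, s n w @[n --> \oo] --> X w.

Record L2fun : Type := MkL2fun {
  L2fun_val :> T -> H ;
  L2fun_strongly_measurable : strongly_measurable L2fun_val ;
  L2fun_moment2 : ('E_P[(fun w => `|L2fun_val w| ^+ 2)%R] < +oo)%E }.

HB.instance Definition _ := gen_eqMixin L2fun.
HB.instance Definition _ := gen_choiceMixin L2fun.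

Definition L2_eq (X Y : L2fun) : bool :=
  `[< {ae P, forall w, X w = Y w} >].

Lemma L2_eq_refl : reflexive L2_eq.
Proof. by move=> X; apply/asboolP; apply: aeW. Qed.

Lemma L2_eq_sym : symmetric L2_eq.
Proof.
by move=> X Y; apply/idP/idP => /asboolP h; apply/asboolP;
  apply: filterS h => w ->.
Qed.

Lemma L2_eq_trans : transitive L2_eq.
Proof.
move=> Y X Z /asboolP XY /asboolP YZ; apply/asboolP.
by apply: filterS2 XY YZ => w -> ->.
Qed.

Canonical L2_eq_equiv := EquivRel L2_eq L2_eq_refl L2_eq_sym L2_eq_trans.

Definition L2 : Type := {eq_quot L2_eq}%qT.
HB.instance Definition _ := Choice.on L2.
HB.instance Definition _ := EqQuotient.on L2.

Definition L2_rep (X : L2) : T -> H := repr X.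

(* Both quantities are independent of the chosen representatives, see
   [moment2_pi] and [msd_pi] below. *)
Definition moment2 (X : L2) : \bar R := 'E_P[(fun w => `|L2_rep X w| ^+ 2)%R].

Definition msd (X Y : L2) : \bar R :=
  'E_P[(fun w => `|L2_rep X w - L2_rep Y w| ^+ 2)%R].

Lemma simple_comp (s r : T -> H) (g : H -> H -> R) :
  simple_function s -> simple_function r ->
  measurable_fun setT (fun w => g (s w) (r w)).
Proof.
move=> [fs ms] [fr mr] mT A mA; rewrite setTI.
have -> : (fun w => g (s w) (r w)) @^-1` A =
  \bigcup_(y in range s) (\bigcup_(z in range r)
    (if pselect (A (g y z)) then s @^-1` [set y] `&` r @^-1` [set z]
     else set0)).
  apply/seteqP; split=> w /=.
    move=> Aw; exists (s w); first by exists w.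
    by exists (r w); [exists w|case: pselect].
  by move=> [y _ [z _]]; case: pselect => // Ayz [/= -> ->].
apply: fin_bigcup_measurable => [|y sy]; first exact: fs.
apply: fin_bigcup_measurable => [|z rz]; first exact: fr.
case: pselect => [Ayz|nAyz] /=; last exact: measurable0.
by apply: measurableI; [exact: ms|exact: mr].
Qed.

Lemma measurable_norm_sub (X Y : T -> H) :
  strongly_measurable X -> strongly_measurable Y ->
  measurable_fun setT (fun w => `|X w - Y w| ^+ 2).
Proof.
move=> [s ss sX] [r rs rY]; apply: measurable_funX.
apply: (@measurable_fun_cvg _ _ _ setT (fun n w => `|s n w - r n w|)) => //.
  by move=> n; apply: (simple_comp (fun x y => `|x - y|)).
by move=> w _; apply: cvg_norm; apply: cvgB.
Qed.

Lemma strongly_measurable0 : strongly_measurable (fun=> 0).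
Proof.
exists (fun _ _ => 0) => [n|w]; last exact: cvg_cst.
split; last first.
  move=> y; rewrite preimage_cst; case: ifP => _; first exact: measurableT.
  exact: measurable0.
by apply: (@sub_finite_set _ _ [set 0]) => // y [_ _ <-].
Qed.

Lemma L2_pi_ae (f : L2fun) :
  {ae P, forall w, L2_rep (\pi_L2 f)%qT w = f w}.
Proof.
have : repr (\pi_L2 f)%qT = f %[mod L2]%qT by rewrite reprK.
by move/eqmodP/asboolP.
Qed.

Lemma msd_pi (f g : L2fun) :
  msd (\pi_L2 f)%qT (\pi_L2 g)%qT = 'E_P[(fun w => `|f w - g w| ^+ 2)%R]%E.
Proof.
rewrite /msd unlock; apply: ge0_ae_eq_integral => //.
- apply/measurable_EFinP/measurable_norm_sub;
    exact: L2fun_strongly_measurable.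
- apply/measurable_EFinP/measurable_norm_sub;
    exact: L2fun_strongly_measurable.
- move: (L2_pi_ae f) (L2_pi_ae g); apply: filterS2 => w fw gw _.
  by rewrite fw gw.
Qed.

Lemma moment2_pi (f : L2fun) :
  moment2 (\pi_L2 f)%qT = 'E_P[(fun w => `|f w| ^+ 2)%R]%E.
Proof.
have m0 (g : L2fun) : measurable_fun setT (fun w => (`|g w| ^+ 2)%:E).
  under eq_fun do rewrite -[g _]subr0.
  apply/measurable_EFinP/measurable_norm_sub; last exact: strongly_measurable0.
  exact: L2fun_strongly_measurable.
rewrite /moment2 unlock; apply: ge0_ae_eq_integral => //; first exact: m0.
- by move: (L2_pi_ae f); apply: filterS => w fw _; rewrite fw.
Qed.

(* Processes are total functions of a real time; only their values at times
   [t >= 0] are constrained. *)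
Definition continuous_process (X : R -> L2) : Prop :=
  forall s : R, 0 <= s ->
    (fun t => msd (X t) (X s)) @ within [set t | 0 <= t] (nbhs s) --> 0%E.

Definition bounded_process (X : R -> L2) : Prop :=
  exists2 K : R, 0 < K & forall t : R, 0 <= t -> (moment2 (X t) <= K%:E)%E.

Definition periodic_limit (omega : R) (X : R -> L2) : Prop :=
  [/\ continuous_process X, bounded_process X &
    exists Xt : R -> L2, forall t : R, 0 <= t ->
      msd (X (t + n%:R * omega)) (Xt t) @[n --> \oo] --> 0%E].

Definition bounded_L2_set (K : set L2) : Prop :=
  exists2 M : R, 0 < M & forall X, K X -> (moment2 X <= M%:E)%E.

(* Joint continuity at the points of [R_+ x L2], for the norm of [L2]. *)
Definition jointly_continuous (f : R -> L2 -> L2) : Prop :=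
  forall (s : R) (Y : L2), 0 <= s -> forall eps : R, 0 < eps ->
    exists2 delta : R, 0 < delta &
      forall (t : R) (X : L2), 0 <= t -> `|t - s| < delta ->
        (msd X Y < delta%:E)%E -> (msd (f t X) (f s Y) < eps%:E)%E.

(* [bounded_process] is required of each [f ^~ X]; a bound uniform over all of
   [L2] would make the boundedness over each bounded [K] redundant. *)
Definition periodic_limit_unif (omega : R) (f : R -> L2 -> L2) : Prop :=
  [/\ jointly_continuous f, forall X : L2, bounded_process (f ^~ X) &
    forall K : set L2, bounded_L2_set K ->
      bounded_L2_set [set Z | exists t X, [/\ 0 <= t, K X & Z = f t X]] /\
      exists ft : R -> L2 -> L2, forall (t : R) (X : L2), 0 <= t -> K X ->
        msd (f (t + n%:R * omega) X) (ft t X) @[n --> \oo] --> 0%E].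

Definition lipschitz_L2 (f : R -> L2 -> L2) : Prop :=
  exists2 L : R, 0 < L & forall (t : R) (Y Z : L2), 0 <= t ->
    (msd (f t Y) (f t Z) <= L%:E * msd Y Z)%E.

End L2.

(* Main.v *)
Require Import Defs.
From mathcomp Require Import all_boot all_order all_algebra.
From mathcomp Require Import all_classical all_reals all_analysis.
From mathcomp Require Import measurable_realfun lra.

Set Implicit Arguments.
Unset Strict Implicit.
Unset Printing Implicit Defensive.

Import Order.TTheory GRing.Theory Num.Theory.
Import numFieldNormedType.Exports.

Local Open Scope classical_set_scope.
Local Open Scope ring_scope.

(* The estimate [E|A - C|^2 <= 2 (E|A - B|^2 + E|B - C|^2)] bounds
   [msd (f (t + n omega) (X (t + n omega))) (ft t (Xt t))] by
   [2 (L msd (X (t + n omega)) (Xt t) + msd (f (t + n omega) (Xt t)) (ft t (Xt t)))],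
   where [Xt] and [ft] are the limits for [X] and [f]. The same estimate bounds
   the moments of [Xt], so that one ball contains all values of both [X] and
   [Xt], and [ft] can be taken relative to that ball. *)

Section SquareMean.
Context (d : measure_display) (T : measurableType d) (R : realType).
Context (P : probability T R) (H : completeNormedModType R).

(** Integrates the pointwise bound [(b + c)^2 <= 2 (b^2 + c^2)], which is [0 <= (b - c)^2]
    rearranged. Working with functions rather than classes in [L2] allows [W] to be the zero
    function. *)
Lemma expectation_sqr_norm_triangle (U V W : T -> H) :
  strongly_measurable U -> strongly_measurable V -> strongly_measurable W ->
  ('E_P[(fun w => `|U w - W w| ^+ 2)%R] <=
   2%:E * ('E_P[(fun w => `|U w - V w| ^+ 2)%R]
         + 'E_P[(fun w => `|V w - W w| ^+ 2)%R]))%E.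
Proof.
move=> mU mV mW; have mUV := measurable_norm_sub mU mV.
have mVW := measurable_norm_sub mV mW.
rewrite unlock -ge0_integralD//; [|exact/measurable_EFinP..].
rewrite -ge0_integralZl//; [|exact/measurable_EFinP/measurable_funD|].
- apply: ge0_le_integral => //.
  + exact/measurable_EFinP/measurable_norm_sub.
  + apply/measurable_EFinP/measurable_funM => //.
    exact: measurable_funD.
  move=> w _; rewrite -EFinD -EFinM lee_fin.
  have := ler_distD (V w) (U w) (W w); move: (normr_ge0 (U w - W w)).
  move: `|U w - W w| `|U w - V w| `|V w - W w| => a b c a0 abc.
  have := sqr_ge0 (b - c); rewrite !expr2 => bc.
  have : a * a <= (b + c) * (b + c) by exact: ler_pM.
  lra.
- by move=> w _; rewrite adde_ge0.
Qed.

Lemma L2_rep_strongly_measurable (X : L2 P H) :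
  strongly_measurable (L2_rep X).
Proof. exact: L2fun_strongly_measurable. Qed.

Lemma msd_ge0 (X Y : L2 P H) : (0 <= msd X Y)%E.
Proof. by apply: expectation_ge0 => w; rewrite exprn_ge0. Qed.

Lemma msdC (X Y : L2 P H) : msd X Y = msd Y X.
Proof. by rewrite /msd; under eq_fun do rewrite distrC. Qed.

Lemma msd_triangle (X Y Z : L2 P H) :
  (msd X Z <= 2%:E * (msd X Y + msd Y Z))%E.
Proof.
by apply: expectation_sqr_norm_triangle; exact: L2_rep_strongly_measurable.
Qed.

(** The second moment is the squared distance to the zero function, so this is the previous estimate
    with [0] as third point. *)
Lemma moment2_le_msd (X Y : L2 P H) :
  (moment2 X <= 2%:E * (msd X Y + moment2 Y))%E.
Proof.
have moment2E (Z : L2 P H) :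
    moment2 Z = 'E_P[(fun w => `|L2_rep Z w - 0| ^+ 2)%R]%E.
  by rewrite /moment2; under [in RHS]eq_fun do rewrite subr0.
rewrite !moment2E; apply: expectation_sqr_norm_triangle;
  by [exact: L2_rep_strongly_measurable|exact: strongly_measurable0].
Qed.

Lemma cvg_msd0P (I : Type) (F : set_system I) (FF : Filter F)
    (X Y : I -> L2 P H) :
  msd (X i) (Y i) @[i --> F] --> 0%E <->
  forall eps : R, 0 < eps -> \forall i \near F, (msd (X i) (Y i) < eps%:E)%E.
Proof.
split=> [XY eps eps0|XY].
  by apply: (XY [set x | (x < eps%:E)%E]); apply: open_ereal_lt'; rewrite lte_fin.
(* [msd] takes extended real values; the case [eps = 1] makes it eventually finite, which reduces
   the claim to convergence of real numbers. *)
have fin : \forall i \near F, msd (X i) (Y i) \is a fin_num.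
  apply: filterS (XY 1 ltr01) => i XYi.
  by rewrite ge0_fin_numE ?msd_ge0// (lt_trans XYi) ?ltry.
apply/fine_cvgP; split=> //; apply/cvgr0Pnorm_lt => eps eps0.
apply: filterS2 fin (XY eps eps0) => i fini XYi /=.
by rewrite ger0_norm ?fine_ge0 ?msd_ge0// -lte_fin fineK.
Qed.

Lemma continuous_process_comp (f : R -> L2 P H -> L2 P H) (X : R -> L2 P H) :
  jointly_continuous f -> continuous_process X ->
  continuous_process (fun t => f t (X t)).
Proof.
move=> fc Xc s s0; apply/cvg_msd0P => eps eps0.
have [delta delta0 fdelta] := fc s (X s) s0 eps eps0.
have /cvg_msd0P/(_ delta delta0) := Xc s s0.
have : \forall t \near within [set t | 0 <= t] (nbhs s),
    0 <= t /\ `|t - s| < delta.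
  near=> t; split; first by near: t; exact: withinT.
  near: t; apply: cvg_within; near=> t; rewrite distrC.
  by near: t; apply: nbhsx_ballx.
by apply: filterS2 => t [t0 ts] Xts; exact: fdelta.
Unshelve. all: by end_near. Qed.

(** A single index [N] with [msd (Y N) Z < 1] suffices: the [1] in the bound is this distance, the
    factor [2] comes from [moment2_le_msd]. *)
Lemma moment2_limit_le (Y : nat -> L2 P H) (Z : L2 P H) (K : R) :
  (forall n, (moment2 (Y n) <= K%:E)%E) ->
  msd (Y n) Z @[n --> \oo] --> 0%E -> (moment2 Z <= (2 * (1 + K))%:E)%E.
Proof.
move=> YK /cvg_msd0P/(_ 1 ltr01)[N _ /(_ N (leqnn N)) /= YNZ].
apply: le_trans (moment2_le_msd Z (Y N)) _.
by rewrite EFinM lee_pmul2l// EFinD leeD// msdC ltW.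
Qed.

End SquareMean.

Theorem theorem2p5 (R : realType) (d : measure_display) (T : measurableType d)
    (P : probability T R) (H : completeNormedModType R)
    (hilbertH : hilbert_norm H) (separableH : separable_space H)
    (omega : R) (omega_gt0 : 0 < omega)
    (f : R -> L2 P H -> L2 P H)
    (f_periodic : periodic_limit_unif omega f)
    (f_lipschitz : lipschitz_L2 f)
    (X : R -> L2 P H) (X_periodic : periodic_limit omega X) :
  periodic_limit omega (fun t => f t (X t)).
Proof.
have [fc _ fK] := f_periodic; have [L L0 fL] := f_lipschitz.
have [Xc [K K0 XK] [Xt XXt]] := X_periodic.
have shift_ge0 (t : R) n : 0 <= t -> 0 <= t + n%:R * omega.
  by move=> t0; rewrite addr_ge0// mulr_ge0// ltW.
have M0 : 0 < 2 * (1 + K) by lra.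
(* The bound is the one that [moment2_limit_le] gives for [Xt]; it exceeds [K], so the values of [X]
   lie in [B] too. *)
pose B := [set Z : L2 P H | (moment2 Z <= (2 * (1 + K))%:E)%E].
have BX t : 0 <= t -> B (X t).
  by move=> t0; apply: le_trans (XK t t0) _; rewrite lee_fin; lra.
have BXt t : 0 <= t -> B (Xt t).
  move=> t0; apply: (@moment2_limit_le _ _ _ _ _ _ _ K _ (XXt t t0)) => n.
  exact/XK/shift_ge0.
have bB : bounded_L2_set B by exists (2 * (1 + K)).
(* [B] does not depend on [t], so one [ft] serves all times; [M] bounds the moments of
   [f t (X t)]. *)
have [[M M_gt0 fM] [ft fft]] := fK B bB.
split; first exact: continuous_process_comp.
  exists M => // t t0; apply: fM; exists t, (X t); split => //.
  exact: BX.
exists (fun t => ft t (Xt t)) => t t0.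
pose s n := t + n%:R * omega.
pose u n := (2%:E * (L%:E * msd (X (s n)) (Xt t)
  + msd (f (s n) (Xt t)) (ft t (Xt t))))%E.
apply: (@squeeze_cvge _ _ _ _ (fun=> 0%E) _ u).
- apply: nearW => n; rewrite msd_ge0/=.
  (* With this middle point, the Lipschitz bound is used at the shifted time [s n], and the limit of
     [f] only at the fixed argument [Xt t]. *)
  apply: le_trans (msd_triangle _ (f (s n) (Xt t)) _) _.
  by rewrite lee_pmul2l// leeD2r// fL// shift_ge0.
- exact: cvg_cst.
- rewrite -[0%E](mule0 2%:E); apply: cvgeZl => //.
  rewrite -[0%E]adde0; apply: cvgeD => //; last by apply: fft => //; exact: BXt.
  by rewrite -[0%E](mule0 L%:E); apply: cvgeZl => //; exact: XXt.
Qed.
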